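(* Let $M$ be a regular matroid on ground set $E$, represented over $\mathbb{R}$ by a totally unimodular matrix $A$. For $e\in E$ define the polyhedron $$P^\uparrow_{\mathrm{circuit}}(M,e):=\{x\in\mathbb{R}^E \mid \exists y\in\mathbb{R}^E:\ -x\le y\le x,\ Ay=\mathbf{0},\ y_e=1,\ -\mathbf{1}\le y\le \mathbf{1}\}.$$ Then $P^\uparrow_{\mathrm{circuit}}(M)=\mathrm{conv}\left(\bigcup_{e\in E}P^\uparrow_{\mathrm{circuit}}(M,e)\right)$. In particular, $\mathrm{xc}(P^\uparrow_{\mathrm{circuit}}(M))=O(|E|^2)$.
   Context: The circuit dominant of a matroid $M$ is $P^\uparrow_{\mathrm{circuit}}(M):=\mathrm{conv}\{\chi^C\in\{0,1\}^{E(M)} : C \text{ a circuit of } M\}+\mathbb{R}^{E(M)}_+$, where $\chi^C$ is the characteristic vector. The extension complexity $\mathrm{xc}(P)$ of a polyhedron $P$ is the minimum number of facets (inequality constraints) of a polyhedron $Q$ that maps onto $P$ under an affine map. A matroid is regular if it is representable over every field; a matrix $A$ represents $M$ over $\mathbb{R}$ if the independent sets of $M$ are the sets of linearly independent columns. *)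

(* Defs.v *)
From HB Require Import structures.
From mathcomp Require Import all_boot all_order all_algebra.
From mathcomp Require Import boolp classical_sets cardinality reals.

Set Implicit Arguments.
Unset Strict Implicit.
Unset Printing Implicit Defensive.

Import Order.TTheory GRing.Theory Num.Theory.
Local Open Scope ring_scope.
Local Open Scope classical_set_scope.
Local Open Scope card_scope.

Record matroid (E : finType) := Matroid {
  indep : {set E} -> bool;
  indep0 : indep finset.set0;
  indepS : forall I J : {set E}, J \subset I -> indep I -> indep J;
  indep_augment : forall I J : {set E}, indep I -> indep J ->
    (#|I| < #|J|)%N -> exists2 e, e \in J :\: I & indep (e |: I)%SET
}.

Definition circuit (E : finType) (M : matroid E) (C : {set E}) : bool :=
  minset (fun D : {set E} => ~~ indep M D) C.

(* The column of [A] indexed by [e : E] is the column number [enum_rank e].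
   [free] is about families: two equal columns are linearly dependent. *)
Definition represents (F : fieldType) (E : finType) (m : nat)
    (A : 'M[F]_(m, #|E|)) (M : matroid E) : Prop :=
  forall S : {set E},
    indep M S = free [seq col (enum_rank e) A | e <- enum S].

Definition regular (E : finType) (M : matroid E) : Prop :=
  forall F : fieldType, exists (m : nat) (A : 'M[F]_(m, #|E|)), represents A M.

(* Reordering the rows and columns of a square submatrix only changes the sign
   of its determinant, so the selections need not be increasing. *)
Definition totally_unimodular (R : nzRingType) (m n : nat) (A : 'M[R]_(m, n)) :
    Prop :=
  forall (k : nat) (f : 'I_k -> 'I_m) (g : 'I_k -> 'I_n),
    injective f -> injective g -> \det (mxsub f g A) \in [:: -1; 0; 1].

Section Polyhedra.
Context {R : realType}.

Definition conv (V : lmodType R) (S : set V) : set V :=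
  [set x | exists (k : nat) (l : 'I_k -> R) (v : 'I_k -> V),
    [/\ forall i, 0 <= l i, \sum_i l i = 1, forall i, S (v i) &
        x = \sum_i l i *: v i]].

Definition polyhedron (V : lmodType R) (Q : set V) : Prop :=
  exists (k : nat) (a : 'I_k -> {scalar V}) (b : 'I_k -> R),
    Q = [set x | forall i, a i x <= b i].

(* Faces are nonempty, so a point has no facet. *)
Definition face (V : lmodType R) (Q F : set V) : Prop :=
  F !=set0 /\ exists (c : {scalar V}) (d : R),
    (forall x, Q x -> c x <= d) /\ F = Q `&` [set x | c x = d].

Definition facet (V : lmodType R) (Q F : set V) : Prop :=
  [/\ face Q F, F <> Q &
      forall G, face Q G -> F `<=` G -> G = F \/ G = Q].

Definition maps_onto (U V : lmodType R) (Q : set U) (P : set V) : Prop :=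
  exists (f : {linear U -> V}) (v : V), [set f x + v | x in Q] = P.

Definition has_extension (V : lmodType R) (P : set V) (k : nat) : Prop :=
  exists (d : nat) (Q : set 'cV[R]_d),
    [/\ polyhedron Q, maps_onto Q P & [set F | facet Q F] #= `I_k].

(* "xc(P) = k", as a relation because xc(P) is finite only for polyhedra. *)
Definition is_xc (V : lmodType R) (P : set V) (k : nat) : Prop :=
  has_extension P k /\ forall l, has_extension P l -> (k <= l)%N.

Section Circuit.
Variable E : finType.

(* [R^o] is [R] as a module over itself. *)
Definition chi (C : {set E}) : {ffun E -> R^o} := [ffun e => (e \in C)%:R].

Definition circuit_dominant (M : matroid E) : set {ffun E -> R^o} :=
  [set x + z | x in conv [set chi C | C in [set C | circuit M C]]
             & z in [set z : {ffun E -> R^o} | forall e, 0 <= z e]].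

Definition circuit_dominant_at (m : nat) (A : 'M[R]_(m, #|E|)) (e : E) :
    set {ffun E -> R^o} :=
  [set x | exists y : {ffun E -> R^o},
    [/\ forall f, - x f <= y f <= x f,
        A *m (\col_j y (enum_val j)) = 0,
        y e = 1 &
        forall f, -1 <= y f <= 1]].

End Circuit.
End Polyhedra.

(* Main.v *)
Require Import Defs.
From HB Require Import structures.
From mathcomp Require Import all_boot all_order all_algebra.
From mathcomp Require Import boolp classical_sets cardinality reals.
From mathcomp Require Import ring lra.

Set Implicit Arguments.
Unset Strict Implicit.
Unset Printing Implicit Defensive.

Import Order.TTheory GRing.Theory Num.Theory.
Local Open Scope ring_scope.

(** A subset of columns of [A] is dependent iff it contains the support of a
    nonzero vector of [ker A].  If the support of [y] in [ker A] is a circuit,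
    Cramer's rule and total unimodularity make [|y|] constant on it; otherwise
    [y] is a sum of two kernel vectors with the same sign pattern and smaller
    supports.  Hence [|y|] is a conic combination of characteristic vectors of
    circuits, and those circuits that contain [e] have total weight [|y e|].

    So, with [p e], [q e] nonnegative in R^E for each [e] in [E], the system
    [A (p e - q e) = 0], [\sum_e (p e e - q e e) = 1] projects, by
    [\sum_e (p e + q e)], into the circuit dominant; it also covers the convex
    hull of the polyhedra of the theorem, which contains the circuit dominant.
    It has [2 |E|^2] inequalities, and every facet of a polyhedron is cut out
    by one of its defining inequalities. *)

(** * Kernel vectors of a representation and dependent sets *)

Section KernelVectors.
Variables (F : fieldType) (E : finType) (m : nat) (A : 'M[F]_(m, #|E|)).
Implicit Types (y u : E -> F) (S : {set E}).

Definition kernel_vector y :=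
  forall i, \sum_f A i (enum_rank f) * y f = 0.

Definition supp y : {set E} := finset (fun f => y f != 0).

Lemma in_supp y f : (f \in supp y) = (y f != 0).
Proof. by rewrite inE. Qed.

Lemma notin_supp S y f : supp y \subset S -> f \notin S -> y f = 0.
Proof.
by move=> /fintype.subsetP sS; apply: contraNeq => yf; apply: sS; rewrite inE.
Qed.

Lemma kernel_vectorP y :
  kernel_vector y <-> A *m (\col_j y (enum_val j)) = 0.
Proof.
have E1 i : (A *m (\col_j y (enum_val j))) i 0 =
            \sum_f A i (enum_rank f) * y f.
  rewrite mxE (reindex enum_rank) /=; last by apply/onW_bij/enum_rank_bij.
  by apply: eq_bigr => f _; rewrite mxE enum_rankK.
split=> [ky | Ay i]; last by rewrite -E1 Ay mxE.
by apply/matrixP => i j; rewrite ord1 E1 ky mxE.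
Qed.

Lemma kernel_vectorD a b y u : kernel_vector y -> kernel_vector u ->
  kernel_vector (fun f => a * y f + b * u f).
Proof.
move=> ky ku i; rewrite (eq_bigr (fun f =>
  a * (A i (enum_rank f) * y f) + b * (A i (enum_rank f) * u f))).
  by rewrite big_split /= -!mulr_sumr ky ku !mulr0 addr0.
by move=> f _; rewrite mulrDr !(mulrCA (A _ _)).
Qed.

Lemma kernel_vectorZ a y : kernel_vector y -> kernel_vector (fun f => a * y f).
Proof.
move=> ky i; rewrite (eq_bigr (fun f => a * (A i (enum_rank f) * y f))).
  by rewrite -mulr_sumr ky mulr0.
by move=> f _; rewrite mulrCA.
Qed.

(** Turns a relation among the columns of [S] into a vector on [E]; [G] will be the family of
    columns. *)
Lemma extend_by_zero S (k : 'I_#|S| -> F) : exists y,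
  [/\ forall i, y (enum_val i) = k i, supp y \subset S &
      forall V : lmodType F, forall G : E -> V,
        \sum_f y f *: G f = \sum_i k i *: G (enum_val i)].
Proof.
pose y f := \sum_(i : 'I_#|S| | enum_val i == f) k i.
exists y; split.
- move=> i; rewrite /y (bigD1 i) //= big1 ?addr0 // => j.
  by case/andP => /eqP/enum_val_inj ->; rewrite eqxx.
- apply/fintype.subsetP => f; rewrite in_supp; apply: contraNT => fS.
  rewrite /y big1 // => i /eqP fE; move: fS; rewrite -fE.
  by have -> := enum_valP i.
- move=> V G; under eq_bigr do rewrite scaler_suml.
  rewrite (exchange_big_dep xpredT) //=; apply: eq_bigr => i _.
  by rewrite (big_pred1 (enum_val i)) // => f; rewrite eq_sym.
Qed.

Lemma sum_supp S y (V : lmodType F) (G : E -> V) : supp y \subset S ->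
  \sum_f y f *: G f = \sum_(i < #|S|) y (enum_val i) *: G (enum_val i).
Proof.
move=> sS; rewrite -(big_enum_val (A := mem S) (fun f => y f *: G f)) /=.
rewrite [RHS]big_mkcond /=; apply: eq_bigr => f _; case: ifPn => // fS.
by rewrite (notin_supp sS fS) scale0r.
Qed.

Lemma kernel_vector_cols y :
  kernel_vector y <-> \sum_f y f *: col (enum_rank f) A = 0.
Proof.
have E1 i : (\sum_f y f *: col (enum_rank f) A) i 0 =
            \sum_f A i (enum_rank f) * y f.
  by rewrite summxE; apply: eq_bigr => f _; rewrite !mxE mulrC.
split=> [ky | Ay i]; last by rewrite -E1 Ay mxE.
by apply/matrixP => i j; rewrite ord1 E1 ky mxE.
Qed.

Variable M : matroid E.
Hypothesis AM : represents A M.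

Lemma indep_kernel S : indep M S ->
  forall y, kernel_vector y -> supp y \subset S -> forall f, y f = 0.
Proof.
rewrite AM => fr y /kernel_vector_cols ky sS f.
have [fS | fS] := boolP (f \in S); last exact: notin_supp fS.
have sz : size [seq col (enum_rank e) A | e <- enum S] == #|S|.
  by rewrite size_map -cardE.
move/(@freeP _ _ _ (Tuple sz)): fr => /(_ (fun i => y (enum_val i))) fr.
have <- : enum_val (enum_rank_in fS f) = f by rewrite enum_rankK_in.
apply: fr; rewrite -[RHS]ky (sum_supp _ sS); apply: eq_bigr => i _.
by congr (_ *: _); rewrite (nth_map (enum_val i)) -?cardE // -enum_val_nth.
Qed.

Lemma dep_kernel S : ~~ indep M S ->
  exists y, [/\ kernel_vector y, supp y \subset S & exists f, y f != 0].
Proof.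
have sz : size [seq col (enum_rank e) A | e <- enum S] == #|S|.
  by rewrite size_map -cardE.
rewrite AM => /(@freeP _ _ _ (Tuple sz)) fr; apply/not_existsP => no; apply: fr.
move=> k k0 i; have [y [yk sS yE]] := extend_by_zero k.
apply/eqP; apply: contra_notT (no y) => ki; split => //; last first.
  by exists (enum_val i); rewrite yk.
apply/kernel_vector_cols; rewrite yE -[RHS]k0; apply: eq_bigr => j _.
by congr (_ *: _); rewrite (nth_map (enum_val j)) -?cardE // -enum_val_nth.
Qed.

Lemma supp_dep y f : kernel_vector y -> y f != 0 -> ~~ indep M (supp y).
Proof.
move=> ky yf; apply/negP => /indep_kernel/(_ y ky (subxx _) f) y0.
by rewrite y0 eqxx in yf.
Qed.

Lemma circuit_dep C : circuit M C -> ~~ indep M C.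
Proof. by case/minsetP. Qed.

Lemma circuit_proper C S : circuit M C -> S \proper C -> indep M S.
Proof.
case/minsetP => _ minC SC; apply: contraTT (SC) => dS.
by rewrite (minC _ dS (proper_sub SC)) fintype.properxx.
Qed.

(** The dependent set [supp y] contains a circuit, properly since it is not one itself, and that
    circuit carries a kernel vector. *)
Lemma noncircuit_kernel y : kernel_vector y -> (exists f, y f != 0) ->
  ~~ circuit M (supp y) ->
  exists u, [/\ kernel_vector u, supp u \proper supp y & exists f, u f != 0].
Proof.
move=> ky [f yf] nC.
have [C cC sC] :=
  @minset_exists _ (fun D => ~~ indep M D) _ (supp_dep ky yf).
have [u [ku su u0]] := dep_kernel (circuit_dep cC); exists u; split => //.
apply: sub_proper_trans su _; rewrite finset.properEneq sC andbT.
by apply: contraNneq nC => <-.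
Qed.

End KernelVectors.

(** * Cramer's rule and total unimodularity *)

(** Multiply by the adjugate of [B]: entry [i] becomes the expansion of [\det B'] along column [i],
    whose cofactors are the same in [B] and [B']. *)
Lemma cramer_col (R : comNzRingType) (k : nat) (B B' : 'M[R]_k)
    (v : 'cV[R]_k) (i : 'I_k) :
  (forall r j, j != i -> B' r j = B r j) -> B *m v = col i B' ->
  \det B * v i 0 = \det B'.
Proof.
move=> eqB Bv.
have: (\adj B *m (B *m v)) i 0 = \det B * v i 0.
  by rewrite mulmxA mul_adj_mx mul_scalar_mx mxE.
move=> <-; rewrite Bv mxE (expand_det_col B' i); apply: eq_bigr => r _.
rewrite !mxE mulrC; congr (_ * (_ * \det _)).
by apply/matrixP => s j; rewrite !mxE eqB // eq_sym neq_lift.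
Qed.

(** Deleting [e] from the circuit leaves independent columns, so some rows cut out a square
    submatrix of determinant 1 or -1. Cramer's rule then gives [y f] as [y e] times a
    subdeterminant, up to sign. *)
Lemma tu_circuit_le (R : realFieldType) (E : finType) (m : nat)
    (A : 'M[R]_(m, #|E|)) (M : matroid E) (C : {set E}) (y : E -> R) (e f : E) :
  represents A M -> totally_unimodular A -> circuit M C ->
  kernel_vector A y -> supp y \subset C -> e \in C -> `|y f| <= `|y e|.
Proof.
move=> AM tuA cC ky sy eC.
have [->// | fe] := eqVneq f e.
have [fC | fC] := boolP (f \in C); last first.
  by rewrite (notin_supp sy fC) normr0.
pose S := (C :\ e)%SET.
have iS : indep M S by apply: circuit_proper cC _; rewrite properD1.
pose g (i : 'I_#|S|) := enum_rank (enum_val i).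
(* Full column rank: a relation among these columns extends by zero to a kernel vector supported in
   the independent set [S]. *)
have rf : row_full (colsub g A).
  rewrite /row_full -mxrank_tr; apply: inj_row_free => v v0.
  have [u [uv su uE]] := extend_by_zero (fun i => v 0 i).
  have u0 : kernel_vector A u.
    apply/kernel_vector_cols; rewrite uE; apply/matrixP => r c.
    rewrite ord1 summxE; move/matrixP/(_ 0 r): v0; rewrite !mxE => v0.
    by rewrite -[RHS]v0; apply: eq_bigr => j _; rewrite !mxE.
  by apply/rowP => i; rewrite -uv (indep_kernel AM iS u0) // mxE.
pose h := fullrankfun rf.
have uB := fullrowsub_unit rf.
pose B := mxsub h g A.
have BE : rowsub (fullrankfun rf) (colsub g A) = B.
  by apply/matrixP => r c; rewrite !mxE.
have ginj : injective g by move=> i j /enum_rank_inj/enum_val_inj.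
have hinj : injective h by apply: fullrankfun_inj.
have norm1 (k : nat) (f' : 'I_k -> 'I_m) (g' : 'I_k -> 'I_#|E|) :
    injective f' -> injective g' -> `|\det (mxsub f' g' A)| <= 1.
  move=> i1 i2; have := tuA k f' g' i1 i2; rewrite !inE.
  by case/or3P=> /eqP ->; rewrite ?normrN ?normr0 ?normr1.
have dB : `|\det B| = 1.
  have := tuA _ h g hinj ginj; rewrite BE unitmxE unitfE in uB.
  rewrite !inE (negPf uB) /= => /orP[]/eqP ->; by rewrite ?normrN normr1.
have fS : f \in S by rewrite !inE fe.
pose i0 := enum_rank_in fS f.
have i0E : enum_val i0 = f by rewrite enum_rankK_in.
(* Column [f] is exchanged for column [e], which is not among the columns of [S], so the selection
   stays injective. *)
pose g' i := if i == i0 then enum_rank e else g i.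
have gNe i : g i != enum_rank e.
  apply/eqP => /enum_rank_inj vE; have := enum_valP i.
  by rewrite vE !inE eqxx.
have g'inj : injective g'.
  move=> i j; rewrite /g'; case: eqP => [->|_]; case: eqP => [->|_] //.
  - by move/esym/eqP; rewrite (negPf (gNe _)).
  - by move/eqP; rewrite (negPf (gNe _)).
  - exact: ginj.
(* The new column is the right-hand side of the system solved by [y] on [S], once the term of [e] is
   moved across. *)
pose B' := \matrix_(r, j)
  (if j == i0 then - y e * A (h r) (enum_rank e) else B r j).
have := @cramer_col _ _ B B' (\col_i y (enum_val i)) i0.
have -> : \det B' = - y e * \det (mxsub h g' A).
  rewrite (expand_det_col _ i0) [\det (mxsub _ _ _)](expand_det_col _ i0).
  rewrite mulr_sumr; apply: eq_bigr => r _; rewrite !mxE /g' eqxx -mulrA.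
  congr (_ * (_ * (_ * \det _))); apply/matrixP => s j; rewrite !mxE.
  by rewrite eq_sym (negPf (neq_lift _ _)).
rewrite mxE i0E => cramer.
have {}cramer : \det B * y f = - y e * \det (mxsub h g' A).
  apply: cramer.
    by move=> r j ji; rewrite mxE (negPf ji).
  apply/matrixP => r c; rewrite !mxE eqxx.
  have := ky (h r); rewrite (bigD1 e) //= => /eqP.
  rewrite addrC addr_eq0 mulrC -mulNr => /eqP <-.
  rewrite [RHS](eq_bigl (fun f => (f != e))) //.
  transitivity (\sum_(f in S) A (h r) (enum_rank f) * y f).
    rewrite (big_enum_val (A := mem S) (fun f => A (h r) (enum_rank f) * y f)).
    by apply: eq_bigr => j _; rewrite !mxE.
  rewrite [LHS]big_mkcond [RHS]big_mkcond; apply: eq_bigr => j _.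
  rewrite !inE; case: eqVneq => //= _; case: ifPn => // jC.
  by rewrite (notin_supp sy jC) mulr0.
have := congr1 Num.norm cramer; rewrite !normrM dB mul1r normrN => ->.
by rewrite ler_piMr // norm1.
Qed.

(** * Conformal decomposition of kernel vectors *)

Section ConformalDecomposition.
Variables (R : realFieldType) (E : finType) (m : nat) (A : 'M[R]_(m, #|E|)).
Implicit Types y u : E -> R.

(** A ratio test: [t] is the least [y f / u f] over the coordinates where [u] and [y] have the same
    strict sign. There [t * u f] does not overshoot [y f], elsewhere no sign can flip, and the
    minimiser leaves the support. *)
Lemma reduce_support y u f0 : kernel_vector A y -> kernel_vector A u ->
    supp u \subset supp y -> 0 < u f0 * y f0 ->
  exists t, [/\ 0 < t, kernel_vector A (fun f => y f - t * u f),
    supp (fun f => y f - t * u f) \proper supp y &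
    forall f, 0 <= (y f - t * u f) * y f].
Proof.
move=> ky ku su uy0; pose P f := 0 < u f * y f.
case: (@arg_minP _ _ _ f0 P (fun f => y f / u f) uy0) => f1 Pf1 minf1.
set t := y f1 / u f1.
have nz f : P f -> u f != 0.
  by rewrite /P; apply: contraTneq => ->; rewrite mul0r ltxx.
have ratio f : P f -> y f / u f = (u f * y f) / u f ^+ 2.
  by move=> /nz uf; rewrite expr2 invfM mulrA (mulrAC (u f)) divff // mul1r.
have sq f : P f -> 0 < u f ^+ 2 by move=> /nz uf; rewrite exprn_even_gt0.
have t0 : 0 < t by rewrite /t ratio // divr_gt0 // sq.
exists t; split => //.
- move=> i; rewrite -[RHS](kernel_vectorD 1 (- t) ky ku i).
  by apply: eq_bigr => f _; rewrite mul1r mulNr.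
- apply/properP; split.
    apply/fintype.subsetP => f; rewrite !in_supp; apply: contraNneq => yf.
    by rewrite yf (notin_supp su) ?in_supp ?yf ?eqxx // mulr0 subr0.
  exists f1; rewrite in_supp.
    by move: Pf1; rewrite /P; apply: contraTneq => ->; rewrite mulr0 ltxx.
  by rewrite /t divfK ?subrr ?eqxx // nz.
- move=> f.
  have -> : (y f - t * u f) * y f = y f ^+ 2 - t * (u f * y f) by ring.
  have [Pf | nPf] := boolP (P f).
    have uf := nz f Pf.
    have -> : y f ^+ 2 = (y f / u f) * (u f * y f) by field.
    by rewrite -mulrBl mulr_ge0 ?subr_ge0 ?minf1 // ltW.
  rewrite subr_ge0 (le_trans _ (sqr_ge0 _)) // mulr_ge0_le0 ?(ltW t0) //.
  by rewrite leNgt.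
Qed.

(** One reduction yields [y1] with the signs of [y], but the remainder [t * u] may have wrong signs.
    Reducing [y] again, now along [y1], gives two summands that both agree in sign with [y]. *)
Lemma conformal_split y u : kernel_vector A y -> kernel_vector A u ->
    supp u \proper supp y -> (exists f, u f != 0) ->
  exists y1 y2, [/\ kernel_vector A y1, kernel_vector A y2,
    supp y1 \proper supp y, supp y2 \proper supp y &
    forall f, `|y f| = `|y1 f| + `|y2 f|].
Proof.
move=> ky ku su [f0 uf0].
(* Replace [u] by its opposite if needed; the product is nonzero because [supp u] lies in
   [supp y]. *)
wlog uy0 : u ku su uf0 / 0 < u f0 * y f0.
  have yf0 : y f0 != 0.
    apply: contraNneq uf0 => y0.
    by rewrite (notin_supp (proper_sub su)) // in_supp y0 eqxx.
  move=> wl; have [uy | ] := ltP 0 (u f0 * y f0); first exact: (wl u).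
  rewrite le_eqVlt mulf_eq0 (negPf uf0) (negPf yf0) /= => uy.
  apply: (wl (fun f => -1 * u f)); rewrite ?mulN1r ?oppr_eq0 //.
  - exact: kernel_vectorZ.
  - have -> // : supp (fun f => -1 * u f) = supp u.
    by apply/setP => f; rewrite !in_supp mulN1r oppr_eq0.
  - by rewrite mulNr oppr_gt0.
have [t [t0 k1 s1 c1]] := reduce_support ky ku (proper_sub su) uy0.
set y1 := (fun f => y f - t * u f) in k1 s1 c1.
have /properP[_ [f1 yf1 uf1]] := su.
(* Outside [supp u] nothing was subtracted, so [y1] and [y] coincide at [f1]. *)
have y1f1 : 0 < y1 f1 * y f1.
  move: uf1 yf1; rewrite !in_supp negbK /y1 => /eqP -> yf1.
  by rewrite mulr0 subr0 -expr2 exprn_even_gt0.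
have [s [s0 k2 s2 c2]] := reduce_support ky k1 (proper_sub s1) y1f1.
exists (fun f => s * y1 f), (fun f => y f - s * y1 f).
split=> //; first exact: kernel_vectorZ.
  have -> // : supp (fun f => s * y1 f) = supp y1.
  by apply/setP => f; rewrite !in_supp mulf_eq0 gt_eqF.
move=> f; have [y0 | yf] := eqVneq (y f) 0.
  have -> : y1 f = 0 by rewrite (notin_supp (proper_sub s1)) // in_supp y0 eqxx.
  by rewrite mulr0 y0 subr0 normr0 addr0.
(* After multiplication by [|y f|], sign agreement removes every absolute value. *)
apply: (@mulIf _ `|y f|); rewrite ?normr_eq0 // mulrDl -!normrM.
rewrite !ger0_norm ?c2 //; first by ring.
  by rewrite -mulrA mulr_ge0 ?c1 // ltW.
by rewrite -expr2 sqr_ge0.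
Qed.

Variable M : matroid E.
Hypotheses (AM : represents A M) (tuA : totally_unimodular A).

(** Induction on the size of the support: a circuit gets the constant value of [|y|] as its weight,
    and any other support splits conformally. *)
Lemma kernel_conic y : kernel_vector A y ->
  exists mu : {set E} -> R, [/\ forall C, 0 <= mu C,
    forall C, ~~ circuit M C -> mu C = 0 &
    forall f, `|y f| = \sum_C mu C * (f \in C)%:R].
Proof.
have [n] := ubnP #|supp y|; elim: n y => // n IH y; rewrite ltnS => yn ky.
have [y0 | y0] := pselect (exists f, y f != 0); last first.
  exists (fun=> 0); split => // f.
  rewrite big1 => [|C _]; last by rewrite mul0r.
  by apply/eqP; rewrite normr_eq0; apply: contra_notT y0 => yf; exists f.
have [cC | nC] := boolP (circuit M (supp y)).
  case: y0 => e ye; exists (fun C => if C == supp y then `|y e| else 0).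
  split=> [C|C|f]; first by case: ifP.
    by case: eqP => // ->; rewrite cC.
  rewrite (bigD1 (supp y)) //= eqxx big1 ?addr0 => [|C /negPf ->]; last first.
    by rewrite mul0r.
  rewrite in_supp; case: eqVneq => [->|yf]; first by rewrite normr0 mulr0.
  rewrite mulr1; apply/eqP; rewrite eq_le.
  by rewrite !(tu_circuit_le _ AM tuA cC ky) ?in_supp.
have [u [ku su u0]] := noncircuit_kernel AM ky y0 nC.
have [y1 [y2 [k1 k2 s1 s2 yE]]] := conformal_split ky ku su u0.
have [mu1 [p1 c1 e1]] := IH y1 (leq_trans (proper_card s1) yn) k1.
have [mu2 [p2 c2 e2]] := IH y2 (leq_trans (proper_card s2) yn) k2.
exists (fun C => mu1 C + mu2 C); split=> [C|C nCC|f].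
- exact: addr_ge0.
- by rewrite c1 // c2 // addr0.
- by rewrite yE e1 e2 -big_split; apply: eq_bigr => C _; rewrite mulrDl.
Qed.

(** Keep only the weights of circuits through [e]: evaluating the conic combination at [e] gives
    their total, and dropping the others only lowers the sums. *)
Lemma kernel_dominates y w e : kernel_vector A y -> (forall f, `|y f| <= w f) ->
  exists mu : {set E} -> R, [/\ forall C, 0 <= mu C,
    forall C, ~~ circuit M C -> mu C = 0,
    \sum_C mu C = `|y e| &
    forall f, \sum_C mu C * (f \in C)%:R <= w f].
Proof.
move=> /kernel_conic[mu [mu0 muC muE]] yw.
exists (fun C => mu C * (e \in C)%:R); split=> [C|C nC||f].
- by rewrite mulr_ge0.
- by rewrite muC // mul0r.
- by rewrite muE.
- rewrite (le_trans _ (yw f)) // muE; apply: ler_sum => C _.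
  by rewrite -mulrA ler_wpM2l // ler_piMl // lern1 leq_b1.
Qed.

End ConformalDecomposition.

(** * Facets of a polyhedron given by inequalities and equations *)

Section Facets.
Local Open Scope classical_set_scope.
Context {R : realType}.

(** Equations have their own index type so that only inequalities count in the facet bound. *)
Definition linear_system (V : lmodType R) (I J : Type) (a : I -> {scalar V})
    (b : I -> R) (h : J -> {scalar V}) (c : J -> R) : set V :=
  [set x | (forall i, a i x <= b i) /\ (forall j, h j x = c j)].

Variables (V : lmodType R) (I J : finType).
Variables (a : I -> {scalar V}) (b : I -> R) (h : J -> {scalar V}) (c : J -> R).
Let Q := linear_system a b h c.

Lemma polyhedron_linear_system : polyhedron Q.
Proof.
pose K : finType := (I + (J + J))%type.
pose aK (k : K) : {scalar V} := match k with
  | inl i => a i | inr (inl j) => h j | inr (inr j) => (\- h j)%R end.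
pose bK (k : K) := match k with
  | inl i => b i | inr (inl j) => c j | inr (inr j) => - c j end.
exists #|{: K}|, (fun k => aK (enum_val k)), (fun k => bK (enum_val k)).
apply/seteqP; split => x.
  move=> [xa xh] k; case: (enum_val k) => [i|[j|j]] /=; first exact: xa.
    by rewrite xh.
  by rewrite xh.
move=> xK; have {}xK (k : K) : aK k x <= bK k.
  by have := xK (enum_rank k); rewrite enum_rankK.
split=> [i|j]; first exact: (xK (inl i)).
apply/eqP; rewrite eq_le; apply/andP; split; first exact: (xK (inr (inl j))).
by have := xK (inr (inr j)); rewrite /= lerN2.
Qed.

(** A midpoint is slack wherever one of its endpoints is, so slack points for single inequalities
    can be merged one at a time. *)
Lemma common_slack (F : set V) (P : I -> Prop) :
  (forall x y, F x -> F y -> F (2^-1 *: x + 2^-1 *: y)) -> F !=set0 ->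
  (forall x, F x -> Q x) -> (forall i, P i -> exists2 x, F x & a i x < b i) ->
  exists2 x, F x & forall i, P i -> a i x < b i.
Proof.
move=> Fmid [x0 Fx0] FQ Pslack.
suff: forall s : seq I, exists2 x, F x &
    forall i, i \in s -> P i -> a i x < b i.
  move=> /(_ (enum I))[x Fx xP]; exists x => // i.
  by apply: xP; rewrite mem_enum.
elim=> [|i s [x Fx xs]]; first by exists x0.
have [Pi | nPi] := pselect (P i); last first.
  by exists x => // j; rewrite inE => /orP[/eqP->//|]; apply: xs.
have [y Fy yi] := Pslack i Pi.
exists (2^-1 *: x + 2^-1 *: y); first exact: Fmid.
move=> j jis Pj; rewrite linearD !linearZ /=.
have [xQ _] := FQ _ Fx; have [yQ _] := FQ _ Fy.
have := xQ j; have := yQ j.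
move: jis; rewrite inE => /orP[/eqP->|js]; first by lra.
by have := xs j js Pj; lra.
Qed.

Lemma small_step (s t : I -> R) : exists2 eps, 0 < eps &
  forall i, 0 < s i -> eps * t i <= s i.
Proof.
(* [D] bounds each ratio [|t i| / s i]; the summand 1 keeps it positive. *)
pose D := 1 + \sum_(i | 0 < s i) `|t i| / s i.
have D0 : 0 < D.
  by rewrite ltr_wpDr // sumr_ge0 // => i si; rewrite divr_ge0 // ltW.
exists D^-1 => [|i si]; first by rewrite invr_gt0.
rewrite mulrC ler_pdivrMr // (le_trans (ler_norm _)) //.
rewrite mulrC -ler_pdivrMr // /D (bigD1 i) //= addrCA lerDl addr_ge0 //.
by rewrite sumr_ge0 // => j /andP[sj _]; rewrite divr_ge0 // ltW.
Qed.

(** An inequality tight on [F] but not on [Q] cuts out a proper face containing [F], hence [F] by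
    maximality. Without one, some point of [F] is slack in every inequality not identically tight on
    [Q], and a small step from it away from a point of [Q] outside [F] stays in [Q] but violates
    [g <= d]. *)
Lemma facet_linear_system (F : set V) : facet Q F ->
  exists i, F = Q `&` [set x | a i x = b i].
Proof.
move=> [[F0 [g [d [gd FE]]]] FneqQ Fmax].
have FQ x : F x -> Q x by rewrite FE => -[].
have [[i Fi nQ] | no] := pselect (exists2 i, (forall x, F x -> a i x = b i) &
    ~ (forall x, Q x -> a i x = b i)).
  exists i; pose G := Q `&` [set x | a i x = b i].
  have FG : F `<=` G by move=> x Fx; split; [exact: FQ | exact: Fi].
  have faceG : face Q G.
    split; first by case: F0 => x Fx; exists x; exact: FG.
    by exists (a i), (b i); split=> // x [].
  have [//|GQ] := Fmax G faceG FG.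
  by case: nQ => x; rewrite -GQ => -[].
pose P i := ~ (forall x, Q x -> a i x = b i).
have [x Fx xP] : exists2 x, F x & forall i, P i -> a i x < b i.
  apply: common_slack => // [x y|i Pi].
    rewrite FE => -[[xa xh] /= xd] [[ya yh] /= yd].
    split; last by rewrite /= linearD !linearZ /= xd yd; lra.
    split=> k; rewrite linearD !linearZ /=.
      by have := xa k; have := ya k; lra.
    by rewrite xh yh; lra.
  apply: contrapT => nex; apply: no; exists i => // x Fx.
  apply/eqP; rewrite eq_le; have [/(_ i) -> _ /=] := FQ x Fx.
  by rewrite leNgt; apply/negP => lt; apply: nex; exists x.
have [z Qz zd] : exists2 z, Q z & g z < d.
  apply: contrapT => nex; apply: FneqQ; apply/seteqP.
  split => [|z Qz]; first exact: FQ.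
  rewrite FE; split => //=; apply/eqP; rewrite eq_le gd //= leNgt.
  by apply/negP => lt; apply: nex; exists z.
have [eps eps0 epsP] :=
  small_step (fun i => b i - a i x) (fun i => a i x - a i z).
have Qx := FQ x Fx; have gx : g x = d by move: Fx; rewrite FE => -[].
have : Q (x + eps *: (x - z)).
  split=> k; rewrite linearD linearZ linearB /=; last first.
    by case: Qx => _ ->; case: Qz => _ ->; rewrite subrr mulr0 addr0.
  have [Pk | nPk] := pselect (P k).
    by have := epsP k; rewrite subr_gt0 => /(_ (xP k Pk)); lra.
  have {}nPk := contrapT nPk.
  by rewrite !nPk // subrr mulr0 addr0.
move=> /gd; rewrite linearD linearZ linearB /= gx gerDl.
by rewrite leNgt mulr_gt0 // subr_gt0.
Qed.

Lemma card_facets : exists2 k,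
   ([set F | facet Q F] #= `I_k)%card & (k <= #|I|)%N.
Proof.
pose G (n : nat) := if insub n is Some k
  then Q `&` [set x | a (enum_val (k : 'I_#|I|)) x = b (enum_val k)] else set0.
have le : ([set F | facet Q F] #<= `I_(#|I|))%card.
  apply: card_le_trans (card_image_le G _).
  apply: subset_card_le => F /facet_linear_system[i ->].
  exists (enum_rank i : nat); first exact: ltn_ord.
  by rewrite /G valK enum_rankK.
have /finite_setP[k kE] : finite_set [set F | facet Q F].
  by apply/finite_set_leP; exists #|I|.
exists k => //; rewrite -card_le_II; apply: card_le_trans le.
by move/card_eqPle: kE => [].
Qed.

End Facets.

(** * Membership in the circuit dominant, and its inclusion in the hull *)

Section CircuitDominant.
Local Open Scope classical_set_scope.
Context {R : realType}.
Variables (E : finType) (M : matroid E).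

(** Dividing by the total weight, which is at least 1, gives a convex combination and only lowers
    it, so it stays below [x]. *)
Lemma circuit_dominant_of_weights (mu : {set E} -> R) (x : {ffun E -> R^o}) :
    (forall C, 0 <= mu C) -> (forall C, ~~ circuit M C -> mu C = 0) ->
    1 <= \sum_C mu C -> (forall f, \sum_C mu C * (f \in C)%:R <= x f) ->
  circuit_dominant M x.
Proof.
move=> mu0 muC T1 mux; set T := \sum_C mu C in T1.
have T0 : 0 < T by apply: lt_le_trans T1.
pose D := finset (circuit M).
(* Used in [R^o] for the total of the coefficients and in the function space for the point
   itself. *)
have sumD (W : lmodType R) (G : {set E} -> W) :
    \sum_(i < #|D|) (mu (enum_val i) / T) *: G (enum_val i) =
    \sum_C (mu C / T) *: G C.
  rewrite -(big_enum_val (A := mem D) (fun C => (mu C / T) *: G C)) /=.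
  rewrite big_mkcond; apply: eq_bigr => C _; rewrite inE.
  by case: ifPn => // /muC ->; rewrite mul0r scale0r.
pose p : {ffun E -> R^o} := \sum_C (mu C / T) *: chi C.
have pE f : p f = \sum_C mu C / T * (f \in C)%:R.
  by rewrite /p sum_ffunE; apply: eq_bigr => C _; rewrite !ffunE.
exists p.
  exists #|D|, (fun i => mu (enum_val i) / T), (fun i => chi (enum_val i)).
  split=> [i|||]; first by rewrite divr_ge0 // ltW.
  - have := sumD R^o (fun=> 1); rewrite /GRing.scale /= => sumD1.
    under eq_bigr do rewrite -[_ / _]mulr1.
    rewrite sumD1 -[RHS](divff (lt0r_neq0 T0)) /T mulr_suml.
    by apply: eq_bigr => C _; rewrite mulr1.
  - by move=> i; exists (enum_val i) => //; have := enum_valP i; rewrite inE.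
  - by rewrite sumD.
exists (x - p); last by rewrite addrC subrK.
move=> f; rewrite !ffunE subr_ge0 pE (le_trans _ (mux f)) //.
apply: ler_sum => C _; apply: ler_wpM2r => //.
by rewrite ler_pdivrMr // ler_peMr.
Qed.

Variables (m : nat) (A : 'M[R]_(m, #|E|)).

(** The shift [z] is absorbed into each vertex. For a vertex [chi C], a kernel vector supported in
    [C], scaled to 1 at some [e], is the witness; unimodularity bounds its entries by 1. *)
Lemma circuit_dominant_sub_conv :
  represents A M -> totally_unimodular A ->
  circuit_dominant M `<=` conv (\bigcup_(e : E) circuit_dominant_at A e).
Proof.
move=> AM tuA _ [_ [k [l [v [l0 l1 vC ->]]]]] [z z0 <-].
exists k, l, (fun i => v i + z); split => // [i|]; last first.
  under [RHS]eq_bigr do rewrite scalerDr.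
  by rewrite big_split /= -scaler_suml l1 scale1r.
case: (vC i) => C /= cC <-.
have [y [ky sy [e ye]]] := dep_kernel AM (circuit_dep cC).
have eC : e \in C by apply: (fintype.subsetP sy); rewrite in_supp.
have le1 f : `|(y e)^-1 * y f| <= 1.
  rewrite normrM normfV mulrC ler_pdivrMr ?normr_gt0 // mul1r.
  exact: tu_circuit_le cC ky sy eC.
exists e => //; exists [ffun f => (y e)^-1 * y f]; split.
- move=> f; rewrite -ler_norml !ffunE.
  have [fC | fC] := boolP (f \in C).
    by rewrite (le_trans (le1 f)) ?lerDl ?z0.
  by rewrite (notin_supp sy fC) mulr0 normr0 add0r z0.
- apply/kernel_vectorP => i'; rewrite -[RHS](kernel_vectorZ (y e)^-1 ky i').
  by apply: eq_bigr => f _; rewrite ffunE.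
- by rewrite ffunE mulVf.
- by move=> f; rewrite -ler_norml ffunE.
Qed.

End CircuitDominant.

(** * The extended formulation and its projection *)

Section Extension.
Local Open Scope classical_set_scope.
Context {R : realType}.
Variables (E : finType) (m : nat) (A : 'M[R]_(m, #|E|)).

(* A column vector [v] encodes a pair of vectors [p e], [q e] in R^E for each
   [e : E]; [p e - q e] plays the role of the vector y of the paper, scaled by
   the weight of [circuit_dominant_at A e] in a convex combination, and
   [p e + q e] that of x. *)
Let T : finType := (E * E * bool)%type.
Let V := 'cV[R]_#|{: T}|.

Definition ext_coord (b : bool) (v : V) (e f : E) : R :=
  v (enum_rank (e, f, b)) 0.
Definition ext_y (v : V) (e f : E) : R :=
  ext_coord true v e f - ext_coord false v e f.
Definition ext_x (v : V) (e f : E) : R :=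
  ext_coord true v e f + ext_coord false v e f.

Lemma ext_coordP b e f a (v w : V) :
  ext_coord b (a *: v + w) e f = a * ext_coord b v e f + ext_coord b w e f.
Proof. by rewrite /ext_coord !mxE. Qed.

Lemma ext_yP e f a (v w : V) :
  ext_y (a *: v + w) e f = a * ext_y v e f + ext_y w e f.
Proof. by rewrite /ext_y !ext_coordP; ring. Qed.

Lemma ext_xP e f a (v w : V) :
  ext_x (a *: v + w) e f = a * ext_x v e f + ext_x w e f.
Proof. by rewrite /ext_x !ext_coordP; ring. Qed.

Definition ext_proj (v : V) : {ffun E -> R^o} := [ffun f => \sum_e ext_x v e f].

Fact ext_proj_is_linear : linear ext_proj.
Proof.
move=> a v w; apply/ffunP => f.
rewrite !ffunE [X in _ = X + _]mulr_sumr -big_split.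
by apply: eq_bigr => e _; rewrite ext_xP.
Qed.
HB.instance Definition _ :=
  GRing.isLinear.Build R V {ffun E -> R^o} _ ext_proj ext_proj_is_linear.

Definition ext_neg (i : 'I_#|{: T}|) (v : V) : R := - v i 0.

Fact ext_neg_is_scalar i : scalar (ext_neg i).
Proof. by move=> a v w; rewrite /ext_neg !mxE opprD mulrN. Qed.
HB.instance Definition _ i :=
  GRing.isLinear.Build R V R _ (ext_neg i) (ext_neg_is_scalar i).

Definition ext_diag (v : V) : R := \sum_e ext_y v e e.

Fact ext_diag_is_scalar : scalar ext_diag.
Proof.
move=> a v w; rewrite /ext_diag mulr_sumr -big_split.
by apply: eq_bigr => e _; rewrite ext_yP.
Qed.
HB.instance Definition _ :=
  GRing.isLinear.Build R V R _ ext_diag ext_diag_is_scalar.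

Definition ext_row (ie : 'I_m * E) (v : V) : R :=
  \sum_f A ie.1 (enum_rank f) * ext_y v ie.2 f.

Fact ext_row_is_scalar ie : scalar (ext_row ie).
Proof.
move=> a v w; rewrite /ext_row mulr_sumr -big_split.
by apply: eq_bigr => f _; rewrite ext_yP /=; ring.
Qed.
HB.instance Definition _ ie :=
  GRing.isLinear.Build R V R _ (ext_row ie) (ext_row_is_scalar ie).

(** [Some (i, e)] indexes row [i] of the kernel condition on block [e], and [None] the
    normalisation. *)
Definition extension : set V :=
  linear_system (fun i : 'I_#|{: T}| => ext_neg i : {scalar V}) (fun=> 0)
    (fun j : option ('I_m * E) => if j is Some ie then ext_row ie : {scalar V}
       else (ext_diag : {scalar V}))
    (fun j => if j is Some _ then 0 else 1).

Lemma extensionP v : extension v <->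
  [/\ forall b e f, 0 <= ext_coord b v e f, \sum_e ext_y v e e = 1 &
      forall e, kernel_vector A (ext_y v e)].
Proof.
split=> [[v0 vE]|[v0 v1 vA]].
  split=> [b e f||e i]; last exact: (vE (Some (i, e))).
    by have := v0 (enum_rank (e, f, b)); rewrite /= /ext_neg oppr_le0.
  exact: (vE None).
split=> [i|[[i e]|]]; last exact: v1; last exact: vA.
rewrite /= /ext_neg oppr_le0.
have := v0 (enum_val i).2 (enum_val i).1.1 (enum_val i).1.2.
by rewrite /ext_coord -!surjective_pairing enum_valK.
Qed.

Lemma conv_sub_extension :
  conv (\bigcup_(e : E) circuit_dominant_at A e) `<=` ext_proj @` extension.
Proof.
move=> _ [k [l [x [l0 l1 xE ->]]]].
(* Each point of the combination is assigned one element [e], and block [e] collects the points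
   assigned to it. *)
have /choice[eo eoP] : forall i, exists e, circuit_dominant_at A e (x i).
  by move=> i; case: (xE i) => e _ ?; exists e.
have [y yP] := choice eoP.
(* Weighted sums of [(x + y) / 2] and [(x - y) / 2], nonnegative because [-x <= y <= x]. *)
pose p b e f : R := \sum_(i | eo i == e)
  l i * ((x i f + (-1) ^+ (~~ b) * y i f) / 2).
pose v : V := \col_i p (enum_val i).2 (enum_val i).1.1 (enum_val i).1.2.
have vE b e f : ext_coord b v e f = p b e f.
  by rewrite /ext_coord mxE enum_rankK.
have vy e f : ext_y v e f = \sum_(i | eo i == e) l i * y i f.
  by rewrite /ext_y !vE -sumrB; apply: eq_bigr => i _ /=; field.
have vx e f : ext_x v e f = \sum_(i | eo i == e) l i * x i f.
  by rewrite /ext_x !vE -big_split; apply: eq_bigr => i _ /=; field.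
have part (G : 'I_k -> R) : \sum_e \sum_(i | eo i == e) G i = \sum_i G i.
  by rewrite [RHS](partition_big eo xpredT).
exists v; last first.
  apply/ffunP => f; rewrite ffunE; under eq_bigr do rewrite vx.
  by rewrite part sum_ffunE; apply: eq_bigr => i _; rewrite ffunE.
apply/extensionP; split.
- move=> b e f; rewrite vE sumr_ge0 // => i _; rewrite mulr_ge0 // divr_ge0 //.
  by have [/(_ f)] := yP i; case: b => /=; lra.
- under eq_bigr do rewrite vy.
  rewrite -l1 -part; apply: eq_bigr => e _; apply: eq_bigr => i /eqP <-.
  by have [_ _ -> _] := yP i; rewrite mulr1.
- move=> e r; under eq_bigr do rewrite vy mulr_sumr.
  rewrite exchange_big big1 //= => i _.
  have [_ /kernel_vectorP kyi _ _] := yP i.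
  by rewrite -[RHS](kernel_vectorZ (l i) kyi r).
Qed.

(** Decompose each block [e] at its own element [e] and add the weights: their total is at least the
    sum of the diagonal entries, which is 1. *)
Lemma extension_sub_dominant (M : matroid E) :
  represents A M -> totally_unimodular A ->
  ext_proj @` extension `<=` circuit_dominant M.
Proof.
move=> AM tuA _ [v /extensionP[v0 v1 vA] <-].
have yx e f : `|ext_y v e f| <= ext_x v e f.
  rewrite ler_norml /ext_y /ext_x.
  by have := v0 true e f; have := v0 false e f; lra.
have [mu muP] := choice (fun e => kernel_dominates AM tuA e (vA e) (yx e)).
apply: (@circuit_dominant_of_weights _ _ _ (fun C => \sum_e mu e C)).
- by move=> C; apply: sumr_ge0 => e _; case: (muP e).
- by move=> C nC; rewrite big1 // => e _; case: (muP e) => _ -> //.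
- rewrite exchange_big -v1; apply: ler_sum => e _ /=.
  by have [_ _ -> _] := muP e; rewrite ler_norm.
- move=> f; under eq_bigr do rewrite mulr_suml.
  rewrite exchange_big ffunE; apply: ler_sum => e _ /=.
  by have [_ _ _ ->] := muP e.
Qed.

End Extension.

(** * The hull formula and the quadratic bound *)

Local Open Scope classical_set_scope.

Theorem theorem20 (R : realType) :
  (forall (E : finType) (M : matroid E) (m : nat) (A : 'M[R]_(m, #|E|)),
     regular M -> represents A M -> totally_unimodular A ->
     circuit_dominant M = conv (\bigcup_(e : E) circuit_dominant_at A e))
  /\
  (exists K : nat,
     forall (E : finType) (M : matroid E) (m : nat) (A : 'M[R]_(m, #|E|)),
       regular M -> represents A M -> totally_unimodular A ->
       exists k : nat,
         is_xc (@circuit_dominant R E M) k /\ (k <= K * #|E| ^ 2)%N).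
Proof.
split=> [E M m A _ AM tuA|].
  apply/seteqP; split; first exact: circuit_dominant_sub_conv.
  apply: (subset_trans (@conv_sub_extension _ _ _ A)).
  exact: extension_sub_dominant.
(* The constant counts the two signed parts [p] and [q] of each pair in [E * E]. *)
exists 2 => E M m A _ AM tuA.
have [n nE nle] : exists2 n, ([set F | facet (extension A) F] #= `I_n)%card &
    (n <= #|'I_#|{: E * E * bool}| |)%N by exact: card_facets.
have ext : has_extension (@circuit_dominant R E M) n.
  exists _, (extension A); split => //; first exact: polyhedron_linear_system.
  exists (@ext_proj R E), 0; apply/seteqP; split.
    move=> _ [v Qv <-]; rewrite addr0.
    by apply: (extension_sub_dominant AM tuA); exists v.
  move=> x /(circuit_dominant_sub_conv AM tuA)/conv_sub_extension[v Qv <-].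
  by exists v => //; rewrite addr0.
have exP : exists n, `[< has_extension (@circuit_dominant R E M) n >].
  by exists n; apply/asboolP.
exists (ex_minn exP); case: ex_minnP => k /asboolP kext kmin; split.
  by split=> // l lext; apply: kmin; apply/asboolP.
apply: leq_trans (kmin n _) _; first exact/asboolP.
by rewrite (leq_trans nle) // card_ord !card_prod card_bool mulnC mulnn.
Qed.
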